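(* Let $V$ be a finite-dimensional real vector space, let $q\ge0$ and let $\omega\in\Omega^q(\Omega^1\otimes V)$. For every smooth manifold $M$, every $\alpha\in\Omega^1(M;V)$ and every point $p\in M$, the value of $\omega_M(\alpha)$ at $p$ depends only on the $q$-jet of $\alpha$ at $p$.
   Context: An element $\omega\in\Omega^q(\Omega^1\otimes V)$ is a natural transformation of set-valued functors from $M\mapsto\Omega^1(M;V)$ to $M\mapsto\Omega^q(M)$ on the opposite of the category of smooth finite-dimensional manifolds and smooth maps: for each manifold $M$ a map of sets $\omega_M:\Omega^1(M;V)\to\Omega^q(M)$ (no linearity, continuity or locality assumed) such that $\omega_{M'}(f^*\alpha)=f^*\omega_M(\alpha)$ for every smooth $f:M'\to M$. For a vector bundle $E\to M$ and $p\in M$, with $I_p\subset C^\infty(M)$ the ideal of functions vanishing at $p$, the $q$-jet at $p$ of a section of $E$ is its class in $\Omega^0(M;E)/I_p^{q+1}\Omega^0(M;E)$. *)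

(* Defs.v *)
From HB Require Import structures.
From mathcomp Require Import all_boot all_order all_algebra.
From mathcomp Require Import all_classical all_reals all_analysis.

Set Implicit Arguments.
Unset Strict Implicit.
Unset Printing Implicit Defensive.

Import Order.TTheory GRing.Theory Num.Theory.
Import numFieldNormedType.Exports.

Local Open Scope classical_set_scope.
Local Open Scope ring_scope.

(* [f] is of class C^k on the open set [U]; only the values of [f] near the
   points of [U] matter.  C^(k+1) means Frechet differentiable on [U] with all
   directional derivatives of class C^k. *)
Fixpoint Ck (R : realType) (n : nat) (W : normedModType R) (k : nat)
    (U : set 'rV[R]_n) (f : 'rV[R]_n -> W) : Prop :=
  match k with
  | 0 => forall x, U x -> {for x, continuous f}
  | k'.+1 => (forall x, U x -> differentiable f x) /\
             (forall v : 'rV[R]_n, Ck k' U ('D_v f))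
  end.

Definition smooth_on (R : realType) (n : nat) (W : normedModType R)
    (U : set 'rV[R]_n) (f : 'rV[R]_n -> W) : Prop :=
  forall k, Ck k U f.

(* A chart from an open subset [chart_dom] of [T] onto an open subset
   [chart_img] of R^n.  The two maps are total, and their values outside
   [chart_dom] and [chart_img] are irrelevant. *)
Record chart (R : realType) (T : topologicalType) (n : nat) := Chart {
  chart_fun :> T -> 'rV[R]_n;
  chart_inv : 'rV[R]_n -> T;
  chart_dom : set T;
  chart_img : set 'rV[R]_n;
  chart_dom_open : open chart_dom;
  chart_img_open : open chart_img;
  chart_fun_img : forall p, chart_dom p -> chart_img (chart_fun p);
  chart_inv_dom : forall x, chart_img x -> chart_dom (chart_inv x);
  chart_funK : forall p, chart_dom p -> chart_inv (chart_fun p) = p;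
  chart_invK : forall x, chart_img x -> chart_fun (chart_inv x) = x;
  chart_fun_cont : forall p, chart_dom p -> {for p, continuous chart_fun};
  chart_inv_cont : forall x, chart_img x -> {for x, continuous chart_inv}
}.

Definition compatible_charts (R : realType) (T : topologicalType) (n : nat)
    (c d : chart R T n) : Prop :=
  smooth_on (chart_img c `&` chart_inv c @^-1` chart_dom d) (d \o chart_inv c).

(* A smooth manifold without boundary, of pure dimension [dim].  The atlas need
   not be maximal: it stands for the maximal atlas that it generates. *)
Record manifold (R : realType) := Manifold {
  carrier :> topologicalType;
  dim : nat;
  atlas : set (chart R carrier dim);
  manifold_hausdorff : hausdorff_space carrier;
  manifold_second_countable : @second_countable carrier;
  atlas_cover : forall p : carrier, exists2 c, atlas c & chart_dom c p;
  atlas_compatible : forall c d, atlas c -> atlas d -> compatible_charts c d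
}.

Definition is_smooth_map (R : realType) (M N : manifold R) (f : M -> N) :
    Prop :=
  continuous f /\
  forall (c : chart R M (dim M)) (d : chart R N (dim N)), atlas c -> atlas d ->
    smooth_on (chart_img c `&` (f \o chart_inv c) @^-1` chart_dom d)
              (d \o f \o chart_inv c).

Record smooth_map (R : realType) (M N : manifold R) := SmoothMap {
  smooth_map_fun :> M -> N;
  smooth_mapP : is_smooth_map smooth_map_fun
}.

Definition is_smooth_fun (R : realType) (M : manifold R) (f : M -> R) : Prop :=
  forall c : chart R M (dim M), atlas c ->
    smooth_on (chart_img c) (f \o chart_inv c).

(* The tangent space of [M] at [p] is modelled on R^(dim M), identified through
   one chart around [p], chosen once and for all.  Tangent vectors are row
   vectors, so linear maps between tangent spaces act by right multiplication. *)
Definition chart_at (R : realType) (M : manifold R) (p : M) :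
  chart R M (dim M) := s2val (cid2 (atlas_cover p)).

(* The matrix of the differential of [f] at [p]. *)
Definition tangent_mx (R : realType) (M N : manifold R) (f : M -> N) (p : M) :
  'M[R]_(dim M, dim N) :=
  'J (chart_at (f p) \o f \o chart_inv (chart_at p)) (chart_at p p).

(* The rows are the coordinate vector fields of the chart [c], as elements of
   the tangent space at [chart_inv c x]. *)
Definition coord_frame (R : realType) (M : manifold R)
  (c : chart R M (dim M)) (x : 'rV[R]_(dim M)) : 'M[R]_(dim M) :=
  'J (chart_at (chart_inv c x) \o chart_inv c) x.

(* A q-tuple of tangent vectors is the matrix with these vectors as rows. *)
Definition multilinear (R : realType) (q n : nat) (V : vectType R)
    (a : 'M[R]_(q, n) -> V) : Prop :=
  forall (X Y Z : 'M[R]_(q, n)) (i : 'I_q) (b c : R),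
    row i X = b *: row i Y + c *: row i Z ->
    row' i Y = row' i X -> row' i Z = row' i X ->
    a X = b *: a Y + c *: a Z.

Definition alternating (R : realType) (q n : nat) (V : vectType R)
    (a : 'M[R]_(q, n) -> V) : Prop :=
  forall (X : 'M[R]_(q, n)) (i j : 'I_q), i != j -> row i X = row j X ->
    a X = 0.

(* The pullback of [a] along the inverse of the chart [c], at [x]. *)
Definition coord_expr (R : realType) (M : manifold R) (q : nat)
    (V : vectType R) (a : forall p : M, 'M[R]_(q, dim M) -> V)
    (c : chart R M (dim M)) (x : 'rV[R]_(dim M)) (X : 'M[R]_(q, dim M)) : V :=
  a (chart_inv c x) (X *m coord_frame c x).

(* A map to the finite-dimensional space V is smooth when its composites with
   all linear functionals are. *)
Definition is_smooth_form (R : realType) (M : manifold R) (q : nat)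
    (V : vectType R) (a : forall p : M, 'M[R]_(q, dim M) -> V) : Prop :=
  forall (c : chart R M (dim M)), atlas c ->
  forall (X : 'M[R]_(q, dim M)) (l : 'Hom(V, R^o)),
    smooth_on (chart_img c) (fun x => l (coord_expr a c x X)).

(* Omega^q(M; V); the space Omega^q(M) is the case V = R^o. *)
Record dform (R : realType) (M : manifold R) (q : nat) (V : vectType R) :=
  DForm {
    dform_at :> forall p : M, 'M[R]_(q, dim M) -> V;
    dform_multilinear : forall p, multilinear (dform_at p);
    dform_alternating : forall p, alternating (dform_at p);
    dform_smooth : is_smooth_form dform_at
  }.

(* The two sections below only serve to show that pulling back along a smooth
   map preserves smooth forms, so that Omega^q(-; V) is a functor. *)
Section Calculus.
Context {R : realType}.

Lemma near_zero_differentiable (V W : normedModType R) (f : V -> W) x :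
  (\forall y \near x, f y = 0) -> differentiable f x.
Proof.
move=> f0.
have fx : f x = 0 by exact: nbhs_singleton f0.
have E : f \o shift x = cst (f x) + (\0 : {linear V -> W}) +o_ (0 : V) id.
  apply/eqaddoP => e e0; have : \forall h \near (0 : V), f (h + x) = 0.
    move: f0; rewrite (near_shift (0 : V)) /=.
    by apply: filterS => y; rewrite subr0.
  apply: filterS => h fh.
  have -> : (f \o shift x - (cst (f x) + (\0 : {linear V -> W}))) h =
            f (h + x) - (f x + 0) by [].
  by rewrite fh fx addr0 subrr normr0 mulr_ge0// ltW.
have c0 : continuous (\0 : {linear V -> W}) by exact: cst_continuous.
apply/diff_locallyP; rewrite (diff_unique c0 E); split => //; exact: c0.
Qed.

Lemma near_eq_differentiable (V W : normedModType R) (f g : V -> W) x :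
  (\forall y \near x, f y = g y) -> differentiable f x -> differentiable g x.
Proof.
move=> fg df.
have -> : g = f + (g - f) by rewrite addrC subrK.
apply: differentiableD => //; apply: near_zero_differentiable.
by apply: filterS fg => y E; rewrite !fctE /= E subrr.
Qed.

Section Ck.
Context {n : nat}.
Implicit Types (U : set 'rV[R]_n).

Lemma Ck_sub (W : normedModType R) k U U' (f : 'rV[R]_n -> W) :
  U' `<=` U -> Ck k U f -> Ck k U' f.
Proof.
elim: k f => [|k IH] f UU /=; first by move=> h x /UU; exact: h.
by move=> [h1 h2]; split => [x /UU|v]; [exact: h1|exact/IH].
Qed.

Lemma Ck_local (W : normedModType R) k U (f : 'rV[R]_n -> W) :
  (forall x, U x -> exists2 U', U' x & Ck k U' f) -> Ck k U f.
Proof.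
elim: k f => [|k IH] f h.
  by move=> x Ux; have [U' U'x] := h x Ux; exact.
split=> [x Ux|v]; first by have [U' U'x [hU' _]] := h x Ux; exact: hU'.
by apply: IH => x /h[U' U'x [_ hU']]; exists U' => //; exact: hU'.
Qed.

Lemma Ck_eq (W : normedModType R) k U (f g : 'rV[R]_n -> W) :
  open U -> (forall x, U x -> f x = g x) -> Ck k U f -> Ck k U g.
Proof.
move=> oU; have nU x : U x -> \forall y \near x, U y.
  by move=> Ux; apply: open_nbhs_nbhs.
elim: k f g => [|k IH] f g fg /=.
  move=> h x Ux; have fx : f y @[y --> x] --> f x := h _ Ux.
  have E : \forall y \near x, f y = g y by apply: filterS (nU _ Ux) => y /fg.
  rewrite /prop_for /continuous_at -fg//.
  exact: cvg_trans (@near_eq_cvg _ _ (nbhs x) _ _ _ E) fx.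
move=> [h1 h2]; split => [x Ux|v].
  apply: near_eq_differentiable (h1 _ Ux).
  by apply: filterS (nU _ Ux) => y /fg.
apply: IH (h2 v) => x Ux; apply: near_eq_derive.
by apply: filterS (nU _ Ux) => y /fg.
Qed.

Lemma CkW (W : normedModType R) k U (f : 'rV[R]_n -> W) :
  Ck k.+1 U f -> Ck k U f.
Proof.
elim: k f => [|k IH] f [h1 h2] /=.
  by move=> x /h1; exact: differentiable_continuous.
by split => // v; exact: IH.
Qed.

Lemma Ck_cst (W : normedModType R) k U (a : W) : Ck k U (fun=> a).
Proof.
elim: k a => [|k IH] a /=; first by move=> x _; exact: cst_continuous.
split=> [x _|v]; first exact: differentiable_cst.
suff -> : 'D_v (fun=> a) = (fun=> 0) :> (_ -> W) by exact: IH.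
by apply/funext => x; exact: derive_cst.
Qed.

Lemma Ck_add (W : normedModType R) k U (f g : 'rV[R]_n -> W) :
  open U -> Ck k U f -> Ck k U g -> Ck k U (fun x => f x + g x).
Proof.
move=> oU; elim: k f g => [|k IH] f g.
  by move=> hf hg x Ux; apply: continuousD; [exact: hf|exact: hg].
move=> [f1 f2] [g1 g2]; split=> [x Ux|v].
  by apply: differentiableD; [exact: f1|exact: g1].
apply: (Ck_eq oU _ (IH _ _ (f2 v) (g2 v))) => x Ux /=.
by rewrite deriveD//; apply: diff_derivable; [exact: f1|exact: g1].
Qed.

Lemma Ck_mul k U (f g : 'rV[R]_n -> R) :
  open U -> Ck k U f -> Ck k U g -> Ck k U (fun x => f x * g x).
Proof.
move=> oU; elim: k f g => [|k IH] f g.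
  by move=> hf hg x Ux; apply: continuousM; [exact: hf|exact: hg].
move=> hf hg; have [f1 f2] := hf; have [g1 g2] := hg; split=> [x Ux|v].
  by apply: differentiableM; [exact: f1|exact: g1].
have H := Ck_add oU (IH _ _ (CkW hf) (g2 v)) (IH _ _ (CkW hg) (f2 v)).
apply: (Ck_eq oU _ H) => x Ux /=.
by rewrite deriveM//; apply: diff_derivable; [exact: f1|exact: g1].
Qed.

Lemma Ck_sum k U (I : Type) (r : seq I) (f : I -> 'rV[R]_n -> R) :
  open U -> (forall i, Ck k U (f i)) -> Ck k U (fun x => \sum_(i <- r) f i x).
Proof.
move=> oU hf; elim: r => [|i r IH].
  by under eq_fun do rewrite big_nil; exact: Ck_cst.
by under eq_fun do rewrite big_cons; exact: Ck_add.
Qed.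

Lemma Ck_coord m k U (f : 'rV[R]_n -> 'rV[R]_m) j :
  open U -> Ck k U f -> Ck k U (fun x => f x 0 j).
Proof.
move=> oU; elim: k f => [|k IH] f.
  move=> h x Ux.
  by apply: (@continuous_comp _ _ _ f (fun M : 'rV[R]_m => M 0 j));
    [exact: h|exact: coord_continuous].
move=> [h1 h2]; split => [x Ux|v].
  apply: (@differentiable_comp _ _ _ _ f (fun M : 'rV[R]_m => M 0 j)).
    exact: h1.
  exact: differentiable_coord.
apply: (Ck_eq oU _ (IH _ (h2 v))) => x Ux /=.
rewrite derive_mx ?mxE//; exact/diff_derivable/h1.
Qed.

Lemma Ck_comp m k U (U' : set 'rV[R]_m) (f : 'rV[R]_n -> 'rV[R]_m)
    (g : 'rV[R]_m -> R) :
  open U -> open U' -> (forall x, U x -> U' (f x)) ->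
  Ck k U f -> Ck k U' g -> Ck k U (g \o f).
Proof.
move=> oU oU' UU; elim: k g => [|k IH] g.
  by move=> hf hg x Ux; apply: continuous_comp; [exact: hf|exact/hg/UU].
move=> hf hg; have [f1 f2] := hf; have [g1 g2] := hg; split=> [x Ux|v].
  by apply: differentiable_comp; [exact: f1|exact/g1/UU].
have H := @Ck_sum k U _ (index_enum 'I_m)
  (fun j x => ('D_v f x) 0 j * ('D_(delta_mx 0 j) g \o f) x) oU
  (fun j => Ck_mul oU (Ck_coord j oU (f2 v)) (IH _ (CkW hf) (g2 _))).
apply: (Ck_eq oU _ H) => x Ux.
have dg : differentiable g (f x) by exact/g1/UU.
have df : differentiable f x by exact: f1.
rewrite [RHS]deriveE; last exact: differentiable_comp.
rewrite diff_comp// [RHS]/= -(deriveE v df).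
rewrite [in RHS](row_sum_delta ('D_v f x)) linear_sum/=.
by apply: eq_bigr => j _; rewrite linearZ/= -deriveE.
Qed.

End Ck.
End Calculus.

Section Pullback.
Context {R : realType}.

Lemma chart_at_atlas (M : manifold R) (p : M) : atlas (chart_at p).
Proof. exact: (s2valP (cid2 (atlas_cover p))). Qed.

Lemma chart_at_dom (M : manifold R) (p : M) : chart_dom (chart_at p) p.
Proof. exact: (s2valP' (cid2 (atlas_cover p))). Qed.

Lemma open_setI_preimage (S T : topologicalType) (f : S -> T) (A : set S)
    (B : set T) :
  open A -> open B -> (forall x, A x -> {for x, continuous f}) ->
  open (A `&` f @^-1` B).
Proof.
move=> oA oB fc; rewrite openE => x [Ax Bx]; apply: filterI.
  exact: open_nbhs_nbhs.
by apply: (fc _ Ax); exact: open_nbhs_nbhs.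
Qed.

Lemma near_setI_preimage (S T : topologicalType) (f : S -> T) (A : set S)
    (B : set T) x :
  open A -> open B -> (forall x, A x -> {for x, continuous f}) ->
  A x -> B (f x) -> \forall y \near x, A y /\ B (f y).
Proof.
move=> oA oB fc Ax Bx; have := open_setI_preimage oA oB fc.
by rewrite openE; apply.
Qed.

Lemma smooth_on_diff n (W : normedModType R) (U : set 'rV[R]_n)
  (f : 'rV[R]_n -> W) x : smooth_on U f -> U x -> differentiable f x.
Proof. by move=> /(_ 1%N) [h _]; exact: h. Qed.

Lemma near_jacobian n m (f g : 'rV[R]_n -> 'rV[R]_m) x :
  (\forall y \near x, f y = g y) -> differentiable f x -> 'J f x = 'J g x.
Proof.
move=> fg df; have dg := near_eq_differentiable fg df.
have E (v : 'rV[R]_n) : v *m 'J f x = v *m 'J g x.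
  rewrite -[LHS](deriveEjacobian v df).
  rewrite -[RHS](deriveEjacobian v dg).
  exact: near_eq_derive.
apply/row_matrixP => i.
rewrite [LHS]rowE [RHS]rowE.
exact: E.
Qed.

Lemma jacobian_comp n m k (f : 'rV[R]_n -> 'rV[R]_m) (g : 'rV[R]_m -> 'rV[R]_k)
    x :
  differentiable f x -> differentiable g (f x) ->
  'J (g \o f) x = 'J f x *m 'J g (f x).
Proof.
move=> df dg; have dgf := differentiable_comp df dg.
have E (v : 'rV[R]_n) : v *m 'J (g \o f) x = v *m 'J f x *m 'J g (f x).
  rewrite /jacobian [LHS]mul_rV_lin1 [in RHS](mul_rV_lin1 ('d f x)).
  by rewrite [RHS]mul_rV_lin1 diff_comp.
apply/row_matrixP => i; rewrite [LHS]rowE [RHS]rowE mulmxA.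
exact: E.
Qed.

Section OnePullback.
Variables (M' M : manifold R) (f : M' -> M).
Hypothesis fS : is_smooth_map f.

Let read_open (c : chart R M' (dim M')) (d : chart R M (dim M)) :
  open (chart_img c `&` (f \o chart_inv c) @^-1` chart_dom d).
Proof.
apply: open_setI_preimage; [exact: chart_img_open|exact: chart_dom_open|].
move=> x cx; apply: continuous_comp; first exact: chart_inv_cont.
exact: fS.1.
Qed.

Lemma frame_tangent_mx (c : chart R M' (dim M')) (d : chart R M (dim M)) x :
  atlas c -> atlas d -> chart_img c x -> chart_dom d (f (chart_inv c x)) ->
  coord_frame c x *m tangent_mx f (chart_inv c x) =
  'J (d \o f \o chart_inv c) x *m coord_frame d (d (f (chart_inv c x))).
Proof.
move=> ac ad cx dx; rewrite /coord_frame /tangent_mx chart_funK//.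
set p' := chart_inv c x; set p := f p'.
have e1 : differentiable (chart_at p' \o chart_inv c) x.
  apply: smooth_on_diff (atlas_compatible ac (chart_at_atlas p')) _.
  by split => //; exact: chart_at_dom.
have e2 : differentiable (chart_at p \o f \o chart_inv (chart_at p'))
            (chart_at p' p').
  apply: smooth_on_diff (fS.2 _ _ (chart_at_atlas p') (chart_at_atlas p)) _.
  split => /=; first exact/chart_fun_img/chart_at_dom.
  by rewrite chart_funK; exact: chart_at_dom.
have e3 : differentiable (d \o f \o chart_inv c) x.
  exact: smooth_on_diff (fS.2 _ _ ac ad) _.
have e4 : differentiable (chart_at p \o chart_inv d) (d p).
  apply: smooth_on_diff (atlas_compatible ad (chart_at_atlas p)) _.
  split => /=; first exact: chart_fun_img.
  by rewrite chart_funK//; exact: chart_at_dom.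
have dcomp : differentiable
    ((chart_at p \o f \o chart_inv (chart_at p')) \o
     (chart_at p' \o chart_inv c)) x by exact: differentiable_comp.
rewrite -(jacobian_comp e1 e2) -(jacobian_comp e3 e4).
apply: near_jacobian dcomp.
have n1 := near_setI_preimage (@chart_img_open _ _ _ c)
  (@chart_dom_open _ _ _ (chart_at p')) (@chart_inv_cont _ _ _ c) cx
  (chart_at_dom p').
have n2 : \forall y \near x, chart_img c y /\ chart_dom d (f (chart_inv c y)).
  by have := @read_open c d; rewrite openE; apply.
apply: filterS2 n1 n2 => y [_ y1] [_ y2] /=.
by rewrite !chart_funK.
Qed.

Variables (q : nat) (V : vectType R).

Definition pullback_at (a : forall p : M, 'M[R]_(q, dim M) -> V) (p : M')
    (X : 'M[R]_(q, dim M')) : V :=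
  a (f p) (X *m tangent_mx f p).

Lemma multilinear_mulmx m n (T : 'M[R]_(m, n)) (b : 'M[R]_(q, n) -> V) :
  multilinear b -> multilinear (fun X => b (X *m T)).
Proof.
move=> h X Y Z i s t e1 e2 e3; apply: (h _ _ _ i).
- by rewrite !row_mul e1 mulmxDl !scalemxAl.
- by apply/matrixP => u v; have /matrixP/(_ u) e := e2; rewrite !mxE;
    apply: eq_bigr => k _; have := e k; rewrite !mxE => ->.
- by apply/matrixP => u v; have /matrixP/(_ u) e := e3; rewrite !mxE;
    apply: eq_bigr => k _; have := e k; rewrite !mxE => ->.
Qed.

Lemma alternating_mulmx m n (T : 'M[R]_(m, n)) (b : 'M[R]_(q, n) -> V) :
  alternating b -> alternating (fun X => b (X *m T)).
Proof. by move=> h X i j ij e; apply: (h _ i j ij); rewrite !row_mul e. Qed.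

Lemma multilinear_row n (b : 'M[R]_(q, n) -> V) (X : 'M[R]_(q, n)) (i : 'I_q) :
  multilinear b ->
  b X = \sum_j X i j *:
          b (\matrix_(u, v) if u == i then (j == v)%:R else X u v).
Proof.
move=> hb.
pose S (r : 'rV[R]_n) := \matrix_(u, v) if u == i then r 0 v else X u v.
have Srow r : row i (S r) = r.
  by apply/rowP => v; rewrite !mxE eqxx.
have Srow' r r' : row' i (S r) = row' i (S r').
  by apply/matrixP => u v; rewrite !mxE eq_sym (negPf (neq_lift _ _)).
have Slin s t r r' : b (S (s *: r + t *: r')) = s *: b (S r) + t *: b (S r').
  by apply: (hb _ _ _ i); rewrite ?Srow.
have S0 : b (S 0) = 0.
  by have := Slin 0 0 0 0; rewrite !scale0r addr0 => ->; rewrite addr0.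
have Ssum (I : Type) (s : seq I) (w : I -> R) (r : I -> 'rV[R]_n) :
    b (S (\sum_(k <- s) w k *: r k)) = \sum_(k <- s) w k *: b (S (r k)).
  elim: s => [|k s IH]; first by rewrite !big_nil.
  by rewrite !big_cons -[X in S (_ + X)]scale1r Slin IH scale1r.
have -> : X = S (row i X).
  by apply/matrixP => u v; rewrite !mxE; case: eqVneq => // ->.
rewrite [in LHS](row_sum_delta (row i X)) Ssum; apply: eq_bigr => j _.
congr (_ *: b _); first by rewrite !mxE eqxx.
apply/matrixP => u v; rewrite !mxE.
by case: eqVneq => // _; rewrite eqxx eq_sym.
Qed.

Lemma Ck_multilinear n m k (U : set 'rV[R]_n)
    (b : 'rV[R]_n -> 'M[R]_(q, m) -> V) (Z : 'rV[R]_n -> 'M[R]_(q, m))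
    (l : 'Hom(V, R^o)) :
  open U -> (forall x, multilinear (b x)) ->
  (forall X, Ck k U (fun x => l (b x X) : R)) ->
  (forall i j, Ck k U (fun x => Z x i j)) ->
  Ck k U (fun x => l (b x (Z x)) : R).
Proof.
move=> oU bm bS.
suff H : forall N : nat, forall Z : 'rV[R]_n -> 'M[R]_(q, m),
    (forall i j, Ck k U (fun x => Z x i j)) ->
    (forall (i : 'I_q) j x y, (N <= i)%N -> Z x i j = Z y i j) ->
    Ck k U (fun x => l (b x (Z x)) : R).
  by move=> ZS; apply: (H q) => // i j x y; rewrite leqNgt ltn_ord.
elim => [|N IH] {}Z ZS Zc.
  suff -> : (fun x => l (b x (Z x)) : R) = (fun x => l (b x (Z 0)) : R).
    exact: bS.
  by apply/funext => x; congr (l (b x _)); apply/matrixP => i j; exact: Zc.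
have [qN|Nq] := leqP q N.
  apply: IH => // i j x y Ni.
  by have := leq_trans qN Ni; rewrite leqNgt ltn_ord.
pose i0 := Ordinal Nq.
pose Zj j x : 'M[R]_(q, m) :=
  \matrix_(u, v) if u == i0 then (j == v)%:R else Z x u v.
have -> : (fun x => l (b x (Z x)) : R) =
          (fun x => \sum_j Z x i0 j * l (b x (Zj j x))).
  apply/funext => x; rewrite (multilinear_row (Z x) i0 (bm x)) linear_sum/=.
  by apply: eq_bigr => j _; rewrite linearZ.
apply: Ck_sum => // j; apply: Ck_mul => //; apply: IH.
  move=> u v; rewrite /Zj; under eq_fun do rewrite mxE.
  by case: (u == i0); [exact: Ck_cst|exact: ZS].
move=> u v x y Nu; rewrite !mxE; case: eqVneq => // ui0; apply: Zc.
rewrite ltn_neqAle Nu andbT; apply: contra ui0 => /eqP E.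
by apply/eqP/val_inj.
Qed.

Lemma pullback_multilinear (a : dform M q V) p : multilinear (pullback_at a p).
Proof. exact/multilinear_mulmx/dform_multilinear. Qed.

Lemma pullback_alternating (a : dform M q V) p : alternating (pullback_at a p).
Proof. exact/alternating_mulmx/dform_alternating. Qed.

Lemma pullback_smooth (a : dform M q V) : is_smooth_form (pullback_at a).
Proof.
move=> c ac X l k; apply: Ck_local => x0 cx0.
pose d := chart_at (f (chart_inv c x0)).
have ad : atlas d := chart_at_atlas _.
set U := chart_img c `&` (f \o chart_inv c) @^-1` chart_dom d.
have oU : open U := @read_open c d.
exists U; first by split => //; exact: chart_at_dom.
pose F := d \o f \o chart_inv c.
have FS : smooth_on U F := fS.2 _ _ ac ad.
have UF x : U x -> chart_img d (F x) by move=> [_ Ux]; exact: chart_fun_img.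
have H : Ck k U (fun x => l (coord_expr a d (F x) (X *m 'J F x)) : R).
  apply: (@Ck_multilinear _ _ k U (fun x => coord_expr a d (F x))
            (fun x => X *m 'J F x)) => //.
  - by move=> x; exact/multilinear_mulmx/dform_multilinear.
  - move=> Y; have := dform_smooth a ad Y l k.
    exact: (Ck_comp oU (@chart_img_open _ _ _ d) UF (FS k)).
  - move=> i j; under eq_fun do rewrite !mxE.
    apply: Ck_sum => // s; apply: Ck_mul => //; first exact: Ck_cst.
    have [_ /(_ (delta_mx 0 s)) HS] := FS k.+1.
    apply: (Ck_eq oU _ (Ck_coord j oU HS)) => x Ux.
    rewrite deriveEjacobian; last exact: smooth_on_diff FS Ux.
    by rewrite -rowE mxE.
apply: (Ck_eq oU _ H) => x [cx dx].
rewrite /coord_expr /pullback_at -!mulmxA (@frame_tangent_mx c d x)//.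
by rewrite /F /= chart_funK.
Qed.

End OnePullback.
End Pullback.

Definition pullback (R : realType) (M' M : manifold R) (f : smooth_map M' M)
    (q : nat) (V : vectType R) (a : dform M q V) : dform M' q V :=
  DForm (pullback_multilinear f a) (pullback_alternating f a)
        (pullback_smooth (smooth_mapP f) a).

(* Omega^q(Omega^1 (x) V): natural transformations Omega^1(-; V) -> Omega^q(-) *)
Record natural_form (R : realType) (V : vectType R) (q : nat) := NaturalForm {
  natural_form_at :> forall M : manifold R, dform M 1 V -> dform M q R^o;
  natural_form_pullback : forall (M' M : manifold R) (f : smooth_map M' M)
      (a : dform M 1 V),
    natural_form_at (pullback f a) = pullback f (natural_form_at a)
}.

Definition vanishing_ideal (R : realType) (M : manifold R) (p : M) :
  set (M -> R) := [set f | is_smooth_fun f /\ f p = 0].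

(* I_p^k . Omega^q(M; V): finite sums of forms multiplied by products of [k]
   functions vanishing at [p]. *)
Definition ideal_pow_forms (R : realType) (M : manifold R) (p : M) (k : nat)
    (q : nat) (V : vectType R) :
  set (forall x : M, 'M[R]_(q, dim M) -> V) :=
  [set d | exists (m : nat) (h : 'I_m -> 'I_k -> M -> R)
                  (e : 'I_m -> dform M q V),
     (forall i j, vanishing_ideal p (h i j)) /\
     d = fun x X => \sum_i (\prod_j h i j x) *: e i x X].

(* The [k]-jet of [a] at [p], as the coset a + I_p^(k+1) . Omega^q(M; V). *)
Definition jet (R : realType) (M : manifold R) (p : M) (k : nat)
    (q : nat) (V : vectType R) (a : dform M q V) : set (dform M q V) :=
  [set b | ideal_pow_forms p k.+1 (fun x X => b x X - a x X)].

(* Main.v *)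
Require Import Defs.
From mathcomp Require Import all_boot all_order all_algebra.
From mathcomp Require Import all_classical all_reals all_analysis.
From mathcomp Require Import lra.

Set Implicit Arguments.
Unset Strict Implicit.
Unset Printing Implicit Defensive.

Import Order.TTheory GRing.Theory Num.Theory.
Import numFieldNormedType.Exports.

Local Open Scope classical_set_scope.
Local Open Scope ring_scope.

(** Equality of the q-jets of alpha and beta at p means that
      beta = alpha + sum_i h_i0 ... h_iq e_i
    with finitely many terms, each having q+1 function factors that vanish at p.
    The factors h_ij are replaced by independent coordinates t_ij of an
    auxiliary space R^N: on M x R^N consider the form
      A = pr^* alpha + sum_i t_i0 ... t_iq pr^* e_i,
    which pulls back to beta along the graph x |-> (x, h(x)).  By naturality
    omega(beta) at p is obtained from omega(A) at (p, 0), so it is enough that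
    omega(A) and omega(pr^* alpha) agree at (p, 0)
    ([natural_form_univ]).

    Both are q-linear in the tangent vectors, so they may be compared on
    q-tuples of coordinate vectors.  Such a q-tuple involves at most q of the
    directions t_ij; since each product t_i0 ... t_iq has q+1 factors, for each
    i one of the directions t_ij is missing.  Let S be the projection of
    M x R^N onto the coordinate subspace containing M and the directions that
    do occur.  Then S fixes the point (p, 0) and the given vectors, while it
    kills one factor of every product, so S^* A = pr^* alpha.  Naturality of
    omega under S gives the required equality.  This is the only place where
    the number q+1 of factors matters.

    To have all products of manifolds inside Euclidean spaces, with a single
    global chart, the problem is first moved to R^n: there is a smooth map
    f : R^n -> M, defined on all of R^n, sending 0 to p with invertible
    differential at 0 ([exists_global_parametrization]), and the value at p of
    a form on M is determined by the value at 0 of its pullback along f. *)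

(** * Closure properties of C^k maps *)

Section CkClosure.
Context {R : realType} {n : nat}.
Implicit Types (U : set 'rV[R]_n) (k : nat).

Lemma Ck_id k U : Ck k U (@id 'rV[R]_n).
Proof.
elim: k => [|k IH]; first by move=> x _; exact: cvg_id.
split=> [x _|v]; first exact: (@ex_diff _ _ _ _ _ _ _ (is_diff_id x)).
have -> : 'D_v (@id 'rV[R]_n) = fun=> v by apply/funext => x; exact: derive_id.
exact: Ck_cst.
Qed.

Lemma Ck_scalel (W : normedModType R) k U (f : 'rV[R]_n -> R) (w : W) :
  open U -> Ck k U f -> Ck k U (fun x => f x *: w).
Proof.
move=> oU; elim: k f => [|k IH] f.
  move=> hf x Ux; have hx : f y @[y --> x] --> f x := hf x Ux.
  exact: (cvgZ hx (@cvg_cst _ w _ _ _)).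
move=> [f1 f2]; split=> [x Ux|v]; first exact/differentiableZl/f1.
apply: (Ck_eq oU _ (IH _ (f2 v))) => x Ux /=.
rewrite !deriveE; [|exact/differentiableZl/f1|exact: f1].
by rewrite diffZl//; exact: f1.
Qed.

(** Converse of [Ck_coord]: smoothness of vector-valued maps is checked on
    coordinates, which are scalar functions and can be multiplied and
    inverted. *)
Lemma Ck_rV m k U (f : 'rV[R]_n -> 'rV[R]_m) :
  open U -> (forall j, Ck k U (fun x => f x 0 j)) -> Ck k U f.
Proof.
move=> oU hf.
have -> : f = fun x => \sum_j f x 0 j *: delta_mx 0 j.
  by apply/funext => x; exact: row_sum_delta.
elim: (index_enum _) => [|j s IH].
  by under eq_fun do rewrite big_nil; exact: Ck_cst.
by under eq_fun do rewrite big_cons; apply: Ck_add => //; exact: Ck_scalel.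
Qed.

Lemma Ck_prod k U (I : Type) (r : seq I) (f : I -> 'rV[R]_n -> R) :
  open U -> (forall i, Ck k U (f i)) ->
  Ck k U (fun x => \prod_(i <- r) f i x).
Proof.
move=> oU hf; elim: r => [|i r IH].
  by under eq_fun do rewrite big_nil; exact: Ck_cst.
by under eq_fun do rewrite big_cons; exact: Ck_mul.
Qed.

(** The derivative of 1/f is -f'/f^2, again built from 1/f, so the induction
    on k closes. *)
Lemma Ck_inv k U (f : 'rV[R]_n -> R) :
  open U -> (forall x, U x -> f x != 0) -> Ck k U f ->
  Ck k U (fun x => (f x)^-1).
Proof.
move=> oU f0; elim: k => [|k IH].
  by move=> hf x Ux; apply: continuousV; [exact: f0|exact: hf].
move=> hf; have [f1 f2] := hf.
split=> [x Ux|v]; first by apply: differentiableV; [exact: f1|exact: f0].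
have fV := IH (CkW hf).
have H := Ck_mul oU (Ck_mul oU (Ck_cst k U (-1 : R)) (Ck_mul oU fV fV)) (f2 v).
apply: (Ck_eq oU _ H) => x Ux /=.
rewrite [RHS](@deriveV _ _ f); [|exact: f0|exact/diff_derivable/f1].
by rewrite -exprVn expr2 mulN1r.
Qed.

Lemma smooth_mulmx m (L : 'M[R]_(n, m)) : smooth_on setT (mulmxr L).
Proof.
move=> k; apply: Ck_rV => [|j]; first exact: openT.
under eq_fun do rewrite mxE.
apply: Ck_sum => [|i]; first exact: openT.
apply: Ck_mul; [exact: openT| |exact: Ck_cst].
apply: Ck_coord; [exact: openT|exact: Ck_id].
Qed.

Lemma jacobian_mulmx m (L : 'M[R]_(n, m)) x : 'J (mulmxr L) x = L.
Proof.
have c : continuous (mulmxr L : 'rV[R]_n -> 'rV[R]_m).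
  by move=> y; exact: (@smooth_mulmx m L 0%N y I).
apply/row_matrixP => i; rewrite !rowE /jacobian mul_rV_lin1.
by rewrite diff_lin.
Qed.

End CkClosure.

(** * Euclidean spaces as manifolds *)

Section Euclidean.
Context {R : realType}.
Implicit Types n : nat.

Definition rat_box n (ab : 'rV[rat]_n * 'rV[rat]_n) : set 'rV[R]_n :=
  [set x | forall j, ratr (ab.1 0 j) < x 0 j < ratr (ab.2 0 j)].

(** Open boxes with rational corners form a countable basis: a matrix
    neighbourhood is a product of neighbourhoods of the entries, and each of
    them contains a rational interval around the entry. *)
Lemma rV_second_countable n : @second_countable 'rV[R]_n.
Proof.
exists (range (@rat_box n)).
  exact: card_le_trans (card_image_le _ _) (countableP _).
split.
  move=> _ [ab _ <-]; rewrite openE => x xab.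
  exists (fun _ j => `]ratr (ab.1 0 j), ratr (ab.2 0 j)[%classic) => [i j|y Py].
    rewrite ord1; apply: open_nbhs_nbhs; split; first exact: interval_open.
    by rewrite /= in_itv/=; exact: xab.
  by move=> j; have := Py 0 j; rewrite /= in_itv.
move=> x A [P xP PA].
have /choice[f fP] j : exists ab : rat * rat, ratr ab.1 < x 0 j < ratr ab.2 /\
    forall y : R, ratr ab.1 < y < ratr ab.2 -> P 0 j y.
  have /nbhs_ballP[e /= e0 eP] := xP 0 j.
  have [a /itvP ax] : exists a, ratr a \in `](x 0 j - e), (x 0 j)[.
    by apply: rat_in_itvoo; rewrite ltrBlDr ltrDl.
  have [b /itvP bx] : exists b, ratr b \in `](x 0 j), (x 0 j + e)[.
    by apply: rat_in_itvoo; rewrite ltrDl.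
  exists (a, b); split => [|y /andP[ay yb]]; first by rewrite ax bx.
  apply: eP; rewrite /ball/= distrC ltr_distl.
  rewrite (lt_trans _ ay) ?ax//= (lt_trans yb)// ?bx//.
exists (rat_box (\row_j (f j).1, \row_j (f j).2)).
  by split; [exists (\row_j (f j).1, \row_j (f j).2)|
    move=> j; rewrite !mxE; exact: (fP j).1].
move=> y yb; apply: PA => i j; rewrite ord1; apply: (fP j).2.
by have := yb j; rewrite !mxE.
Qed.

Lemma id_continuous_at n (x : 'rV[R]_n) : {for x, continuous id}.
Proof. exact: cvg_id. Qed.

Definition id_chart n : chart R 'rV[R]_n n :=
  @Chart R 'rV[R]_n n id id setT setT openT openT
    (fun=> id) (fun=> id) (fun _ _ => erefl) (fun _ _ => erefl)
    (fun x _ => @id_continuous_at n x) (fun x _ => @id_continuous_at n x).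

Lemma id_chart_compatible n (c d : chart R 'rV[R]_n n) :
  [set id_chart n] c -> [set id_chart n] d -> compatible_charts c d.
Proof. by move=> -> -> k; exact: Ck_id. Qed.

Definition euclid n : manifold R :=
  @Manifold R 'rV[R]_n n [set id_chart n] (@norm_hausdorff _ _)
    (rV_second_countable n)
    (fun p => ex_intro2 _ _ (id_chart n) erefl I)
    (@id_chart_compatible n).

Lemma chart_at_euclid n (x : euclid n) : chart_at x = id_chart n.
Proof. exact: (@chart_at_atlas R (euclid n) x). Qed.

Lemma tangent_mx_euclid n m (f : euclid n -> euclid m) x :
  tangent_mx f x = 'J (f : 'rV[R]_n -> 'rV[R]_m) x.
Proof. by rewrite /tangent_mx !chart_at_euclid. Qed.

(** The atlas of R^n is a single global chart, so smoothness of a map out of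
    R^n is only tested in the charts of the target. *)
Lemma smooth_map_from_euclid n (M : manifold R) (f : euclid n -> M) :
  continuous f ->
  (forall d, atlas d -> smooth_on (f @^-1` chart_dom d) (d \o f)) ->
  is_smooth_map f.
Proof.
move=> fc fS; split => // c d -> ad k.
by apply: Ck_sub (fS d ad k) => x [].
Qed.

Lemma smooth_map_euclid n m (f : euclid n -> euclid m) :
  smooth_on setT (f : 'rV[R]_n -> 'rV[R]_m) -> is_smooth_map f.
Proof.
move=> fS; apply: smooth_map_from_euclid => [x|d -> k].
  exact: (fS 0%N x I).
exact: Ck_sub (fS k).
Qed.

Definition linear_map n m (L : 'M[R]_(n, m)) : smooth_map (euclid n) (euclid m)
  := SmoothMap (@smooth_map_euclid n m (mulmxr L) (smooth_mulmx L)).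

Lemma tangent_mx_linear n m (L : 'M[R]_(n, m)) x :
  tangent_mx (linear_map L) x = L.
Proof. rewrite tangent_mx_euclid; exact: jacobian_mulmx. Qed.

End Euclidean.

(** * Forms: extensionality, perturbation, values on basis vectors *)

Section Forms.
Context {R : realType}.

Lemma dform_ext (M : manifold R) q (V : vectType R) (a b : dform M q V) :
  (forall x X, a x X = b x X) -> a = b.
Proof.
case: a b => [a am aa asm] [b bm ba bsm] /= ab.
have {}ab : a = b.
  by apply: functional_extensionality_dep => x; apply/funext => X; exact: ab.
move: am aa asm; rewrite ab => am aa asm.
by congr DForm; exact: Prop_irrelevance.
Qed.

(** The universal form A is a combination of this kind over the ring of smooth
    functions: the coefficients vary from point to point. *)
Section Perturb.
Variables (M : manifold R) (q : nat) (V : vectType R) (m : nat).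
Variables (a : dform M q V) (g : 'I_m -> M -> R) (e : 'I_m -> dform M q V).

Definition perturb_at (x : M) (X : 'M[R]_(q, Defs.dim M)) : V :=
  a x X + \sum_i g i x *: e i x X.

Lemma perturb_multilinear x : multilinear (perturb_at x).
Proof.
move=> X Y Z i b c h1 h2 h3; rewrite /perturb_at.
rewrite (dform_multilinear a x h1 h2 h3) !scalerDr addrACA; congr (_ + _).
rewrite !scaler_sumr -big_split /=; apply: eq_bigr => j _.
rewrite (dform_multilinear (e j) x h1 h2 h3) scalerDr !scalerA.
by rewrite ![g j x * _]mulrC.
Qed.

Lemma perturb_alternating x : Defs.alternating (perturb_at x).
Proof.
move=> X i j ij h; rewrite /perturb_at (dform_alternating a x ij h) add0r.
by apply: big1 => k _; rewrite (dform_alternating (e k) x ij h) scaler0.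
Qed.

Lemma perturb_smooth :
  (forall i, is_smooth_fun (g i)) -> is_smooth_form perturb_at.
Proof.
move=> gS c ac X l k; have oc := @chart_img_open _ _ _ c.
have H := Ck_add oc (dform_smooth a ac X l k)
  (@Ck_sum _ _ k _ _ (index_enum 'I_m) _ oc
    (fun i => Ck_mul oc (gS i c ac k) (dform_smooth (e i) ac X l k))).
apply: (Ck_eq oc _ H) => x _ /=.
rewrite /coord_expr /perturb_at linearD linear_sum; congr (_ + _).
by apply: eq_bigr => i _; rewrite linearZ.
Qed.

Definition perturb (gS : forall i, is_smooth_fun (g i)) : dform M q V :=
  DForm perturb_multilinear perturb_alternating (perturb_smooth gS).

End Perturb.

Definition basis_mx q n (g : 'I_q -> 'I_n) : 'M[R]_(q, n) :=
  \matrix_(i, j) (j == g i)%:R.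

(** The rows are expanded one at a time: the induction hypothesis at stage N
    concerns matrices whose rows of index at least N are already coordinate
    vectors. *)
Lemma multilinear_eq_basis q n (V : vectType R) (a b : 'M[R]_(q, n) -> V) :
  multilinear a -> multilinear b ->
  (forall g, a (basis_mx g) = b (basis_mx g)) -> a =1 b.
Proof.
move=> am bm ab.
suff H : forall N (X : 'M[R]_(q, n)),
    (forall i : 'I_q, (N <= i)%N -> exists j, row i X = delta_mx 0 j) ->
    a X = b X.
  by move=> X; apply: (H q) => i; rewrite leqNgt ltn_ord.
elim=> [|N IH] X hX.
  have /choice[g hg] i : exists j, row i X = delta_mx 0 j by exact: hX.
  suff -> : X = basis_mx g by exact: ab.
  apply/row_matrixP => i; rewrite hg; apply/rowP => j.
  by rewrite !mxE eqxx.
have [qN|Nq] := leqP q N.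
  by apply: IH => i Ni; have := leq_trans qN Ni; rewrite leqNgt ltn_ord.
rewrite (multilinear_row X (Ordinal Nq) am) (multilinear_row X (Ordinal Nq) bm).
apply: eq_bigr => j _; congr (_ *: _); apply: IH => i.
rewrite leq_eqVlt => /predU1P[Ni|Ni].
  exists j; apply/rowP => v; rewrite !mxE eqxx /= [v == j]eq_sym.
  by have -> : i == Ordinal Nq by rewrite -val_eqE /= Ni.
have [k hk] := hX i Ni; exists k; rewrite -hk.
apply/rowP => v; rewrite !mxE ifF//.
by rewrite -val_eqE /=; apply/negbTE; rewrite gtn_eqF.
Qed.

End Forms.

(** * The theorem on Euclidean space *)

Section EuclideanCase.
Context {R : realType}.
Variables (V : vectType R) (q : nat) (omega : natural_form V q).
Variables (n m : nat).
Variables (a b : dform (euclid n) 1 V).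
Variables (h : 'I_m -> 'I_q.+1 -> 'rV[R]_n -> R).
Variable (e : 'I_m -> dform (euclid n) 1 V).
Hypothesis h_smooth : forall i j, smooth_on setT (h i j).
Hypothesis h0 : forall i j, h i j 0 = 0.
Hypothesis b_def : forall (x : euclid n) X,
  b x X = a x X + \sum_i (\prod_j h i j x) *: e i x X.

(** The coordinates t_ij of the auxiliary space are indexed by pairs (i, j),
    listed after the n coordinates of the base. *)
Notation param := ('I_m * 'I_q.+1)%type.
Notation N := #|{: param}|.

Let E : manifold R := euclid (n + N).
Definition param_ix (i : 'I_m) (j : 'I_q.+1) : 'I_(n + N) :=
  rshift n (enum_rank ((i, j) : param)).
Definition univ_coef (i : 'I_m) (y : 'rV[R]_(n + N)) : R :=
  \prod_j y 0 (param_ix i j).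

Lemma univ_coef_smooth i : is_smooth_fun (univ_coef i : E -> R).
Proof.
move=> c -> k; apply: Ck_prod => [|j]; first exact: openT.
by apply: Ck_coord; [exact: openT|exact: Ck_id].
Qed.

(** The matrix of the projection E -> R^n, acting on row vectors. *)
Definition base_mx : 'M[R]_(n + N, n) := col_mx 1%:M 0.

(** The forms pr^* alpha and A on the auxiliary space. *)
Definition univ_base : dform E 1 V := pullback (linear_map base_mx) a.
Definition univ_form : dform E 1 V :=
  perturb univ_base (fun i => pullback (linear_map base_mx) (e i))
    univ_coef_smooth.

(** At the origin omega does not see the perturbation: a q-tuple of coordinate
    vectors misses at least one factor of each product of q+1 coordinates, and
    projecting away the missing directions leaves the vectors unchanged but
    turns the universal form into the unperturbed one. *)
Lemma natural_form_univ : omega E univ_form 0 =1 omega E univ_base 0.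
Proof.
apply: (@multilinear_eq_basis R q (n + N) R^o).
- exact: (@dform_multilinear R E q R^o (omega E univ_form) 0).
- exact: (@dform_multilinear R E q R^o (omega E univ_base) 0).
move=> g.
(* S projects onto the base directions and the directions listed by g: the
   former make it compatible with the projection to the base, the latter make it
   fix the chosen tangent vectors. *)
pose keep (u : 'I_(n + N)) := (u < n)%N || (u \in codom g).
pose S : 'M[R]_(n + N) := diag_mx (\row_u (keep u)%:R).
have SE (y : 'rV[R]_(n + N)) u : (y *m S) 0 u = y 0 u * (keep u)%:R.
  by rewrite mul_mx_diag !mxE.
have SP : S *m base_mx = base_mx.
  apply/matrixP => u v; rewrite mul_diag_mx !mxE /keep.
  by case: splitP => u' _; rewrite mxE ?mulr0// mul1r.
have SX : basis_mx g *m S = basis_mx g.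
  apply/matrixP => i j; rewrite mul_mx_diag !mxE.
  case: eqVneq => [->|_]; rewrite ?mul0r// /keep.
  by rewrite codom_f orbT mulr1.
(* Pigeonhole: the q values of g cannot contain the q+1 coordinates that
   make up the i-th product, so S kills one of them. *)
have Scoef i (y : 'rV[R]_(n + N)) : univ_coef i (y *m S) = 0.
  have [j gj] : exists j, param_ix i j \notin codom g.
    apply/not_existsP => H.
    have : (#|codom (param_ix i)| <= #|codom g|)%N.
      apply/subset_leq_card/fintype.subsetP => _ /codomP[j ->].
      by apply/negPn/negP; exact: H.
    move/leq_trans => /(_ _ (leq_image_card g predT)).
    rewrite card_codom; last by move=> j j' /rshift_inj/enum_rank_inj[].
    by rewrite !card_ord ltnn.
  rewrite /univ_coef (bigD1 j)//= SE /keep (negbTE gj) orbF.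
  by rewrite ltnNge leq_addr mulr0 mul0r.
have SA : pullback (linear_map S) univ_form = univ_base.
  apply: dform_ext => y X /=; rewrite /pullback_at /= /perturb_at.
  rewrite big1 => [|i _]; last by rewrite Scoef scale0r.
  rewrite addr0 /= /pullback_at /=.
  by rewrite !tangent_mx_linear -!mulmxA SP.
rewrite -SA natural_form_pullback /= /pullback_at /= mul0mx.
by rewrite tangent_mx_linear SX.
Qed.

Definition graph (x : 'rV[R]_n) : 'rV[R]_(n + N) :=
  row_mx x (\row_k h (enum_val k).1 (enum_val k).2 x).

Lemma graph_smooth : smooth_on setT graph.
Proof.
move=> k; apply: Ck_rV => [|j]; first exact: openT.
under eq_fun do rewrite mxE.
case: splitP => j' _; first by apply: Ck_coord; [exact: openT|exact: Ck_id].
by under eq_fun do rewrite mxE; exact: h_smooth.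
Qed.

Definition graph_map : smooth_map (euclid n) E :=
  SmoothMap (@smooth_map_euclid R n (n + N) graph graph_smooth).

Lemma graphK x : graph x *m base_mx = x.
Proof. by rewrite mul_row_col mulmx1 mulmx0 addr0. Qed.

Lemma graph0 : graph 0 = 0.
Proof.
by apply/rowP => j; rewrite !mxE; case: splitP => j' _; rewrite mxE ?h0.
Qed.

(** Chain rule for the graph followed by the projection, which is the
    identity. *)
Lemma tangent_mx_graph x : tangent_mx graph_map x *m base_mx = 1%:M.
Proof.
rewrite tangent_mx_euclid.
have gd := smooth_on_diff graph_smooth (I : setT x).
have pd := smooth_on_diff (smooth_mulmx base_mx) (I : setT (graph x)).
rewrite -[base_mx in LHS](jacobian_mulmx base_mx (graph x)).
rewrite -jacobian_comp//.
have -> : mulmxr base_mx \o graph = mulmxr (1%:M : 'M[R]_n).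
  by apply/funext => y /=; rewrite graphK mulmx1.
exact: jacobian_mulmx.
Qed.

Lemma pullback_graph_base q' (V' : vectType R) (c : dform (euclid n) q' V') :
  pullback graph_map (pullback (linear_map base_mx) c) = c.
Proof.
apply: dform_ext => x X /=; rewrite /pullback_at /= /pullback_at /=.
by rewrite graphK tangent_mx_linear -mulmxA tangent_mx_graph mulmx1.
Qed.

(** Along the graph the coordinates t_ij restrict to the functions h_ij, which
    turns the universal perturbation of a into b. *)
Lemma pullback_graph_univ : pullback graph_map univ_form = b.
Proof.
apply: dform_ext => x X; rewrite b_def /= /pullback_at /= /perturb_at.
congr (_ + _).
  by have := congr1 (fun f : dform _ _ _ => f x X) (pullback_graph_base a).
apply: eq_bigr => i _; congr (_ *: _).
  apply: eq_bigr => j _.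
  by rewrite /graph row_mxEr mxE enum_rankK.
by have := congr1 (fun f : dform _ _ _ => f x X) (pullback_graph_base (e i)).
Qed.

Lemma natural_form_euclid X : omega (euclid n) b 0 X = omega (euclid n) a 0 X.
Proof.
rewrite -pullback_graph_univ -[in RHS](pullback_graph_base a).
rewrite !natural_form_pullback /= /pullback_at /= graph0.
by rewrite natural_form_univ natural_form_pullback.
Qed.

End EuclideanCase.

(** * Reduction to Euclidean space *)

Section Localization.
Context {R : realType}.

Lemma denom_gt0 (t : R) : 0 < 1 + t * t.
Proof. by rewrite ltr_pwDl// -expr2 sqr_ge0. Qed.

(** The bound that keeps the reparametrization of [squeeze_into_open] inside a
    ball; t / (1 + t^2) is chosen since it is rational, bounded, and tangent to
    t at 0. *)
Lemma ratio_lt1 (t : R) : `|t * (1 + t * t)^-1| < 1.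
Proof.
have d0 := denom_gt0 t.
rewrite normrM normfV (gtr0_norm d0) ltr_pdivrMr// mul1r.
have := sqr_ge0 (`|t| - 1); rewrite sqrrB1 real_normK ?num_real// expr2.
have := sqr_ge0 t; rewrite expr2; lra.
Qed.

Lemma derive_affine_prod (W : normedModType R) (f g : W -> R) (x v : W)
    (a r : R) :
  derivable f x v -> derivable g x v ->
  'D_v (fun z => a + r * (f z * g z)) x =
  r * (f x * 'D_v g x + g x * 'D_v f x).
Proof.
move=> df dg; have dfg := derivableM df dg.
have drfg := @derivableZ _ _ _ _ r _ _ dfg.
have -> : (fun z => a + r * (f z * g z)) = cst a + r \*: (f * g) by [].
rewrite deriveD; [|exact: derivable_cst|exact: drfg].
rewrite derive_cst add0r.
by rewrite (@deriveZ _ _ _ _ r _ _ dfg) (deriveM df dg).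
Qed.

(** A map defined on the whole of R^n with values in a given open set, yet a
    local diffeomorphism at 0: apply t |-> r t / (1 + t^2) to each coordinate,
    where the ball of radius r for the maximum norm lies in the open set.  The
    differential at 0 is r times the identity. *)
Lemma squeeze_into_open n (U : set 'rV[R]_n) (y : 'rV[R]_n) :
  open U -> U y -> exists phi : 'rV[R]_n -> 'rV[R]_n,
    [/\ smooth_on setT phi, phi 0 = y, forall x, U (phi x) &
        'J phi 0 \in unitmx].
Proof.
move=> oU Uy; have /nbhs_ballP[r /= r0 rU] : nbhs y U by exact: open_nbhs_nbhs.
pose w (t : R) := t * (1 + t * t)^-1.
pose phi (x : 'rV[R]_n) : 'rV[R]_n := \row_j (y 0 j + r * w (x 0 j)).
have coordS j k : Ck k setT (fun x : 'rV[R]_n => x 0 j).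
  by apply: Ck_coord; [exact: openT|exact: Ck_id].
have dS j k : Ck k setT (fun x : 'rV[R]_n => 1 + x 0 j * x 0 j).
  apply: Ck_add; [exact: openT|exact: Ck_cst|].
  by apply: Ck_mul => //; exact: openT.
have wS j k : Ck k setT (fun x : 'rV[R]_n => w (x 0 j)).
  apply: Ck_mul => //; first exact: openT.
  apply: Ck_inv => //; first exact: openT.
  by move=> x _; rewrite gt_eqF// denom_gt0.
have phiS : smooth_on setT phi.
  move=> k; apply: Ck_rV => [|j]; first exact: openT.
  under eq_fun do rewrite mxE.
  apply: Ck_add; [exact: openT|exact: Ck_cst|].
  by apply: Ck_mul => //; [exact: openT|exact: Ck_cst].
have w0 : w 0 = 0 by rewrite /w mul0r.
exists phi; split=> //.
- by apply/rowP => j; rewrite !mxE w0 mulr0 addr0.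
- move=> x; apply: rU; split=> // i j; rewrite ord1 mxE /ball/=.
  rewrite opprD addrA subrr sub0r normrN normrM (gtr0_norm r0).
  by rewrite -[ltRHS]mulr1 ltr_pM2l// ratio_lt1.
have dphi := smooth_on_diff phiS (I : setT 0).
suff -> : 'J phi 0 = r%:M by rewrite unitmxE det_scalar unitrX// unitfE gt_eqF.
apply/row_matrixP => i; rewrite !rowE -deriveEjacobian// mul_mx_scalar.
set v := delta_mx 0 i.
rewrite derive_mx; last exact: diff_derivable.
apply/rowP => j; rewrite !mxE.
under eq_fun do rewrite mxE.
have D f : smooth_on setT f -> derivable (f : 'rV[R]_n -> R) 0 v.
  by move=> fS; apply: diff_derivable; exact: (smooth_on_diff fS I).
have Dx : 'D_v (fun x : 'rV[R]_n => x 0 j) 0 = v 0 j.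
  have := derive_mx (@derivable_id _ _ (0 : 'rV[R]_n) v).
  by rewrite derive_id => /rowP/(_ j) ->; rewrite mxE.
have cx := D _ (coordS j).
have cV : derivable (fun x : 'rV[R]_n => (1 + x 0 j * x 0 j)^-1) 0 v.
  apply: D => k; apply: Ck_inv => //; first exact: openT.
  by move=> x _; rewrite gt_eqF// denom_gt0.
rewrite (derive_affine_prod (y 0 j) r cx cV) Dx mxE mul0r add0r.
by rewrite !mxE mulr0 addr0 invr1 mul1r mulrC.
Qed.

Variables (M : manifold R) (p : M).

(** The inverse of a chart, composed with a map that squeezes R^n into the
    image of that chart. *)
Lemma exists_global_parametrization :
  exists f : smooth_map (euclid (Defs.dim M)) M,
    f 0 = p /\ tangent_mx f 0 \in unitmx.
Proof.
pose c := chart_at p.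
have cp : chart_img c (c p) by exact/chart_fun_img/chart_at_dom.
have [phi [phiS phi0 phiU phiJ]] :=
  squeeze_into_open (@chart_img_open _ _ _ c) cp.
pose f : euclid (Defs.dim M) -> M := chart_inv c \o phi.
have fS : is_smooth_map f.
  have fc : continuous f.
    move=> x; apply: continuous_comp; first exact: (phiS 0%N x I).
    exact: chart_inv_cont.
  apply: smooth_map_from_euclid => // d ad k.
  have oU : open (f @^-1` chart_dom d : set 'rV[R]_(Defs.dim M)).
    by move/continuousP : fc; apply; exact: chart_dom_open.
  apply: Ck_rV => // j.
  have cd := atlas_compatible (chart_at_atlas p) ad k.
  have oV := open_setI_preimage (@chart_img_open _ _ _ c)
    (@chart_dom_open _ _ _ d) (@chart_inv_cont _ _ _ c).
  have := Ck_comp oU oV _ (Ck_sub _ (phiS k)) (Ck_coord j oV cd).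
  apply => // x dx; split => //.
have f0 : f 0 = p by rewrite /f /= phi0 chart_funK//; exact: chart_at_dom.
exists (SmoothMap fS); split; first exact: f0.
have -> : tangent_mx (SmoothMap fS) 0 = 'J (chart_at (f 0) \o f) 0.
  by rewrite /tangent_mx chart_at_euclid.
rewrite f0.
have -> : chart_at p \o f = phi by apply/funext => x; rewrite /f /= chart_invK.
exact: phiJ.
Qed.

Lemma smooth_fun_comp n (f : smooth_map (euclid n) M) (h : M -> R) :
  is_smooth_fun h -> smooth_on setT (h \o f : 'rV[R]_n -> R).
Proof.
move=> hS k; apply: Ck_local => x _.
pose c := chart_at (f x).
have [fc fS] := smooth_mapP f.
have oU : open (f @^-1` chart_dom c : set 'rV[R]_n).
  by move/continuousP : fc; apply; exact: chart_dom_open.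
exists (f @^-1` chart_dom c); first exact: chart_at_dom.
have cS : Ck k (f @^-1` chart_dom c) (c \o f : 'rV[R]_n -> _).
  by apply: Ck_sub (fS (id_chart n) c erefl (chart_at_atlas _) k).
have H := Ck_comp oU (@chart_img_open _ _ _ c) _ cS (hS c (chart_at_atlas _) k).
apply: (Ck_eq oU _ (H _)) => [y cy|y cy]; last exact: chart_fun_img.
by rewrite /= chart_funK.
Qed.

End Localization.

(** A coset contains its representative (the empty sum is zero), so equal
    jets put b in the coset of a. *)
Lemma jet_eq_expansion (R : realType) (M : manifold R) (p : M) k q
    (V : vectType R) (a b : dform M q V) : jet p k a = jet p k b ->
  exists (m : nat) (h : 'I_m -> 'I_k.+1 -> M -> R) (e : 'I_m -> dform M q V),
    (forall i j, vanishing_ideal p (h i j)) /\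
    forall x X, b x X = a x X + \sum_i (\prod_j h i j x) *: e i x X.
Proof.
move=> ab; have : jet p k b b.
  exists 0%N, (fun i => fun=> cst 0), (fun=> b); split => [[]//|].
  apply: functional_extensionality_dep => x; apply/funext => X.
  by rewrite big_ord0 subrr.
rewrite -ab => -[m [h [e [hp E]]]]; exists m, h, e; split => // x X.
have := congr1 (fun f : forall x : M, 'M[R]_(q, Defs.dim M) -> V => f x X) E.
by move=> /= <-; rewrite addrC subrK.
Qed.

Theorem lemma8p6 (R : realType) (V : vectType R) (q : nat)
    (omega : natural_form V q) (M : manifold R) (alpha beta : dform M 1 V)
    (p : M) :
  jet p q alpha = jet p q beta ->
  omega M alpha p = omega M beta p.
Proof.
move=> /jet_eq_expansion[m [h [e [hp E]]]].
have [f [f0 fT]] := exists_global_parametrization p.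
have hS i j : smooth_on setT (h i j \o f : 'rV[R]_(Defs.dim M) -> R).
  by apply: smooth_fun_comp; case: (hp i j).
have hf0 i j : (h i j \o f : 'rV[R]_(Defs.dim M) -> R) 0 = 0.
  by rewrite /= f0; case: (hp i j).
have H := natural_form_euclid omega (a := pullback f alpha)
  (b := pullback f beta) (e := fun i => pullback f (e i)) hS hf0
  (fun x Y => E (f x) (Y *m tangent_mx f x)).
(* The differential of f at 0 is invertible, so every q-tuple X of tangent
   vectors at p is the image of one at 0. *)
apply/funext => X; have := H (X *m invmx (tangent_mx f 0)).
rewrite !natural_form_pullback /= /pullback_at f0.
by rewrite mulmxKV.
Qed.
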